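(* Let $f_1,f_2:\mathbb{R}^n\to\mathbb{R}^n$ be $C^1$ vector fields, let $x_0\in\mathbb{R}^n$, and let $k_1,k_2>0$ be real numbers with $k_1 f_1(x_0)+k_2 f_2(x_0)=\vec 0$ (so $x_0$ is a stasis point). If the derivative (Jacobian matrix) $\frac{d}{dx}\left(k_1 f_1+k_2 f_2\right)$ is non-singular at $x_0$, then there exist two-cycles near $x_0$; that is, for every neighborhood $U$ of $x_0$ there is a two-cycle $x(t)$ for $(f_1,f_2)$ with $x(t)\in U$ for all $t$.
   Context: Consider the differential inclusion $x'\in\{f_1(x),f_2(x)\}$ on $\mathbb{R}^n$, where $f_1,f_2$ are $C^1$. Its trajectories are the continuous, piecewise $C^1$ functions $x(t)$ satisfying the inclusion. A stasis point is a point $x$ at which $f_1(x)\cdot f_2(x)=-|f_1(x)|\,|f_2(x)|$ (the two vector fields are anti-parallel). A two-cycle for $(f_1,f_2)$ is a periodic trajectory $x(t)=x(t+\delta)$ for which there is $\kappa$ with $0<\kappa<\delta$ such that $x'=f_1(x)$ for $0\le t<\kappa$ and $x'=f_2(x)$ for $\kappa\le t<\delta$ (at switching times the derivative is understood as the right-hand derivative). *)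

(* Defs.v *)
From HB Require Import structures.
From mathcomp Require Import all_boot all_order all_algebra.
From mathcomp Require Import all_classical all_reals all_analysis.

Set Implicit Arguments.
Unset Strict Implicit.
Unset Printing Implicit Defensive.

Import Order.TTheory GRing.Theory Num.Theory.
Import numFieldNormedType.Exports.

Local Open Scope classical_set_scope.
Local Open Scope ring_scope.

(* Points of R^n are row vectors 'rV[R]_n, so
   jacobian f x is the transpose of the usual Jacobian matrix. *)

(* The canonical norm `|u| on 'rV[R]_n is the sup norm, whereas stasis points
   are defined with the Euclidean one. *)
Definition dot (R : realType) (n : nat) (u v : 'rV[R]_n) : R :=
  \sum_(i < n) u 0 i * v 0 i.

Definition euclidean_norm (R : realType) (n : nat) (u : 'rV[R]_n) : R :=
  Num.sqrt (dot u u).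

Definition C1_field (R : realType) (n : nat) (f : 'rV[R]_n -> 'rV[R]_n) : Prop :=
  (forall x, differentiable f x) /\ continuous (jacobian f).

Definition stasis_point (R : realType) (n : nat) (f1 f2 : 'rV[R]_n -> 'rV[R]_n)
    (x : 'rV[R]_n) : Prop :=
  dot (f1 x) (f2 x) = - (euclidean_norm (f1 x) * euclidean_norm (f2 x)).

Definition right_derivative (R : realType) (n : nat) (x : R -> 'rV[R]_n)
    (t : R) (v : 'rV[R]_n) : Prop :=
  h^-1 *: (x (t + h) - x t) @[h --> 0^'+] --> v.

Definition left_derivative (R : realType) (n : nat) (x : R -> 'rV[R]_n)
    (t : R) (v : 'rV[R]_n) : Prop :=
  h^-1 *: (x (t + h) - x t) @[h --> 0^'-] --> v.

(* The restriction of x to [a, b] is C^1, with one-sided derivatives at the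
   endpoints. *)
Definition C1_on_segment (R : realType) (n : nat) (x : R -> 'rV[R]_n)
    (a b : R) : Prop :=
  exists v : R -> 'rV[R]_n,
    [/\ {within `[a, b], continuous v},
        right_derivative x a (v a),
        (forall t, a < t < b -> is_derive t 1 x (v t))
      & left_derivative x b (v b)].

(* itv_partition a b s means that a :: s is strictly increasing and ends at b. *)
Definition piecewise_C1 (R : realType) (n : nat) (x : R -> 'rV[R]_n) : Prop :=
  forall a b : R, a < b -> exists2 s : seq R, itv_partition a b s &
    forall i : nat, (i < size s)%N ->
      C1_on_segment x (nth b (a :: s) i) (nth b (a :: s) i.+1).

(* For a piecewise C^1 curve the right-hand derivative exists at every time and
   is the derivative except at switching times. *)
Definition trajectory (R : realType) (n : nat) (f1 f2 : 'rV[R]_n -> 'rV[R]_n)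
    (x : R -> 'rV[R]_n) : Prop :=
  [/\ continuous x, piecewise_C1 x
    & forall t, right_derivative x t (f1 (x t)) \/
                right_derivative x t (f2 (x t))].

(* x' = f(x) for a <= t < b, where a is a switching time. *)
Definition solves_from (R : realType) (n : nat) (f : 'rV[R]_n -> 'rV[R]_n)
    (x : R -> 'rV[R]_n) (a b : R) : Prop :=
  right_derivative x a (f (x a)) /\
  forall t, a < t < b -> is_derive t 1 x (f (x t)).

Definition two_cycle (R : realType) (n : nat) (f1 f2 : 'rV[R]_n -> 'rV[R]_n)
    (x : R -> 'rV[R]_n) : Prop :=
  trajectory f1 f2 x /\
  exists delta kappa : R,
    [/\ 0 < kappa < delta,
        periodic x delta,
        solves_from f1 x 0 kappa
      & solves_from f2 x kappa delta].

(* Main.v *)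
(* With p close to x0 and e > 0 small, follow f1 from p for a time k1 e, and
   follow f2 backwards from p for a time k2 e.  If the two end points agree, the
   first arc followed by the second one is a closed curve, that is, a two-cycle.
   The difference W(p) of the end points satisfies
     W(p) - W(q) = e (p - q) A + o(e |p - q|),  with A = k1 J1 + k2 J2,
   uniformly near x0, where J1, J2 are the Jacobian matrices at x0, and
   W(x0) = O(e^2) because k1 f1(x0) + k2 f2(x0) = 0.  Hence
   p |-> p - e^-1 W(p) A^-1 is a contraction of a ball around x0 for e small, and
   W vanishes at its fixed point. *)

Require Import Defs.
From mathcomp Require Import all_boot all_order all_algebra.
From mathcomp Require Import all_classical all_reals all_analysis.
From mathcomp Require Import ring lra.
Import Order.TTheory GRing.Theory Num.Theory.
Import numFieldNormedType.Exports.
Set Implicit Arguments.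
Unset Strict Implicit.
Unset Printing Implicit Defensive.
Local Open Scope classical_set_scope.
Local Open Scope ring_scope.

(** * Vector-valued calculus *)

(** The estimate of W(p) - W(q) uses neither differentiability of the flow in its initial point nor
    the implicit function theorem. A C^1 field is strictly differentiable at x0: |f(a) - f(b) - (a -
    b) J| <= eta |a - b| for a and b both close to x0. By the mean value inequality alone, two
    solutions started at p and q then follow the linearised motion of p - q up to an error 4 eta |p
    - q| |t|. The order of the choices matters: eta depends on A, k1 and k2 only; it determines the
    radius r, then comes the life time T of the solutions, and e is last. Since the error in W(p) -
    W(q) carries a factor e, dividing by e leaves a contraction factor 1/2 on a ball of radius r / 2
    that does not shrink with e, whereas W(x0) / e = O(e) does. Both arcs leave p at time 0, so the
    f2 arc lives at negative times and every estimate is made on both sides of 0. *)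

Lemma mx_norm_leP (R : realType) (m n : nat) (A : 'M[R]_(m, n)) (c : R) :
  0 <= c -> `|A| <= c <-> forall i j, `|A i j| <= c.
Proof.
move=> c0; rewrite [`|A|]/Num.Def.normr /= mx_normrE; split=> [Ac i j|Ac].
  by apply: le_trans Ac; exact: (le_bigmax _ (fun ij => `|A ij.1 ij.2|) (i, j)).
by apply: bigmax_le => // -[i j] _; exact: Ac.
Qed.

Lemma coord_norm_le (R : realType) (m n : nat) (A : 'M[R]_(m, n)) i j :
  `|A i j| <= `|A|.
Proof. by move: i j; apply/mx_norm_leP. Qed.

Lemma mulmx_norm_le (R : realType) (m n : nat) (u : 'rV[R]_m) (A : 'M[R]_(m, n)) :
  `|u *m A| <= m%:R * `|A| * `|u|.
Proof.
apply/mx_norm_leP => [|i j]; first by rewrite !mulr_ge0.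
rewrite mxE (le_trans (ler_norm_sum _ _ _))//.
rewrite (@le_trans _ _ (\sum_(k < m) `|A| * `|u|))//.
  by apply: ler_sum => k _; rewrite normrM mulrC ler_pM// coord_norm_le.
by rewrite sumr_const card_ord -[leLHS]mulr_natl mulrA.
Qed.

Lemma is_derive_coord (R : realType) (m n : nat) (g : R -> 'M[R]_(m, n)) (t : R)
    (dg : 'M[R]_(m, n)) i j :
  is_derive t 1 g dg -> is_derive t 1 (fun s => g s i j) (dg i j).
Proof.
move=> [gt <-]; apply: DeriveDef; first by move/derivable_mxP : gt; exact.
by rewrite derive_mx// mxE.
Qed.

Lemma is_derive_mx (R : realType) (m n : nat) (g : R -> 'M[R]_(m, n)) (t : R)
    (dg : 'M[R]_(m, n)) :
  (forall i j, is_derive t 1 (fun s => g s i j) (dg i j)) -> is_derive t 1 g dg.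
Proof.
move=> gE; have gt : derivable g t 1 by apply/derivable_mxP => i j; case: (gE i j).
apply: DeriveDef => //; apply/matrixP => i j.
by rewrite derive_mx// mxE; case: (gE i j).
Qed.

(** In the sup norm the scalar mean value theorem applies entry by entry without loss: the
    intermediate times differ between entries, but c bounds the derivative at all of them. *)
Lemma mean_value_inequality (R : realType) (m n : nat) (g dg : R -> 'M[R]_(m, n))
    (a b c : R) : a <= b ->
  (forall t : R, a <= t <= b -> is_derive t 1 g (dg t)) ->
  (forall t : R, a <= t <= b -> `|dg t| <= c) ->
  `|g b - g a| <= c * (b - a).
Proof.
move=> ab gE dgc.
have c0 : 0 <= c by apply: le_trans (dgc a _); rewrite ?lexx.
apply/mx_norm_leP => [|i j]; first by rewrite mulr_ge0// subr_ge0.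
have gijE t : a <= t <= b -> is_derive t 1 (fun s => g s i j) (dg t i j).
  by move=> tab; apply: is_derive_coord; exact: gE.
have [||e /[!in_itv]/= eab ge] :=
  @MVT_segment _ (fun s => g s i j) (fun s => dg s i j) a b ab.
- by move=> t /[!in_itv]/= /andP[at_ tb]; apply: gijE; rewrite !ltW.
- apply: derivable_within_continuous => t /[!in_itv]/= tab.
  by case: (gijE t tab).
rewrite !mxE ge normrM [`|b - a|]ger0_norm ?subr_ge0// ler_wpM2r ?subr_ge0//.
by rewrite (le_trans (coord_norm_le _ _ _))// dgc.
Qed.

Lemma mean_value_inequality_sym (R : realType) (m n : nat)
    (g dg : R -> 'M[R]_(m, n)) (a c : R) :
  (forall t : R, `|t| <= `|a| -> is_derive t 1 g (dg t)) ->
  (forall t : R, `|t| <= `|a| -> `|dg t| <= c) ->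
  `|g a - g 0| <= c * `|a|.
Proof.
move=> gE dgc; have [a0|a0] := leP 0 a.
  rewrite ger0_norm// -{2}[a]subr0; apply: (@mean_value_inequality _ _ _ g dg) => //.
  - by move=> t /andP[t0 ta]; apply: gE; rewrite !ger0_norm.
  - by move=> t /andP[t0 ta]; apply: dgc; rewrite !ger0_norm.
rewrite (ler0_norm (ltW a0)) -[- a]sub0r distrC.
apply: (@mean_value_inequality _ _ _ g dg a 0); first exact: ltW.
- by move=> t /andP[ta t0]; apply: gE; rewrite (ler0_norm t0) (ler0_norm (ltW a0)) lerN2.
- by move=> t /andP[ta t0]; apply: dgc; rewrite (ler0_norm t0) (ler0_norm (ltW a0)) lerN2.
Qed.

Lemma geometric_cvg (R : realType) (n : nat) (u : nat -> 'rV[R]_n) (c : R) :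
  (forall k, `|u k.+1 - u k| <= c / 2 ^+ k) ->
  exists l, forall k, `|l - u k| <= c / 2 ^+ k *+ 2.
Proof.
move=> uc; have c0 : 0 <= c by have := le_trans (normr_ge0 _) (uc 0%N); lra.
(* Subtracting the part of the geometric sum still to come makes the induction on [m] close. *)
have H k m : `|u (k + m)%N - u k| <= c / 2 ^+ k *+ 2 - c / 2 ^+ (k + m) *+ 2.
  elim: m => [|m IH]; first by rewrite addn0 !subrr normr0.
  rewrite -(subrKA (u (k + m)%N)) (le_trans (ler_normD _ _))//.
  rewrite addnS; apply: (le_trans (lerD (uc _) IH)).
  rewrite (exprS _ (k + m)).
  have : 2 ^+ (k + m) != 0 :> R by rewrite expf_neq0.
  set w := 2 ^+ (k + m) => w0.
  rewrite [X in _ <= X](_ : _ = c / w + (c / 2 ^+ k *+ 2 - c / w *+ 2))//.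
  by field; rewrite w0 expf_neq0.
have H' k m : (k <= m)%N -> `|u m - u k| <= c / 2 ^+ k *+ 2.
  move=> /subnKC <-; apply: (le_trans (H _ _)).
  by rewrite lerBlDr lerDl mulrn_wge0// divr_ge0// exprn_ge0.
have C : cauchy (u @ \oo).
  apply/cauchy_ballP => e e0; near_simpl.
  have := cvg_geometric (c *+ 4) (z := 2^-1 :> R).
  rewrite ger0_norm ?invr_ge0// invf_lt1// ltr1n => /(_ isT).
  move/cvgrPdist_lt => /(_ e e0)[N _ Ne].
  exists ([set m | (N <= m)%N], [set m | (N <= m)%N]); first by split; exists N.
  move=> -[p q] /= [Np Nq]; rewrite -ball_normE /ball_ /=.
  have := Ne N (leqnn N); rewrite sub0r normrN /= ger0_norm; last first.
    by rewrite mulr_ge0 ?mulrn_wge0// exprn_ge0// invr_ge0.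
  apply: le_lt_trans; rewrite -(subrKA (u N)) (le_trans (ler_normD _ _))//.
  rewrite (distrC (u N)); apply: (le_trans (lerD (H' _ _ Np) (H' _ _ Nq))).
  by rewrite exprVn mulrnAl -mulrnDr.
have /cvg_ex[l ul] : cvg (u @ \oo) by exact: cauchy_cvg.
exists l => k; apply/ler_addgt0Pr => e e0.
move/cvgrPdist_lt : ul => /(_ e e0)[N _ Ne].
pose m := maxn N k.
rewrite -(subrKA (u m)) (le_trans (ler_normD _ _))// addrC lerD//.
  by apply: H'; rewrite leq_maxr.
by apply: ltW; apply: Ne; rewrite /= leq_maxl.
Qed.

(** * Local existence of solutions *)

Lemma half_pow_small (R : realType) (c e : R) : 0 < e ->
  exists k : nat, c / 2 ^+ k < e.
Proof.
move=> e0; have := @cvg_geometric _ c (2^-1 : R).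
rewrite ger0_norm ?invr_ge0// invf_lt1// ltr1n => /(_ isT).
move/cvgrPdist_lt => /(_ e e0)[N _ Ne]; exists N.
by have := Ne N (leqnn N); rewrite sub0r normrN /= exprVn => /(le_lt_trans (ler_norm _)).
Qed.

Lemma lipschitz_continuous_global (R : realType) (U V : normedModType R)
    (F : U -> V) (L : R) :
  (forall u v, `|F u - F v| <= L * `|u - v|) -> continuous F.
Proof.
move=> FL u; apply/cvgrPdist_lt => e e0.
have L0 : 0 < `|L| + 1 by rewrite ltr_wpDl.
near=> v; apply: (le_lt_trans (FL _ _)).
apply: (@le_lt_trans _ _ ((`|L| + 1) * `|u - v|)).
  by rewrite ler_wpM2r// (le_trans (ler_norm L))// lerDl.
rewrite mulrC -ltr_pdivlMr//; near: v.
by apply: (@cvgr_dist_lt _ _ _ _ _ id) => //; rewrite divr_gt0.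
Unshelve. all: by end_near. Qed.

Lemma is_derive_continuous (R : realType) (V : normedModType R) (g : R -> V)
    (t : R) (dg : V) : is_derive t 1 g dg -> {for t, continuous g}.
Proof. by move=> [/derivable1_diffP /differentiable_continuous]. Qed.

(** The entries are Lebesgue integrals from a, so the derivative is obtained only to the right of a.
    This is the origin of the one-sided domain [- (2 * T) < t] of the solutions. *)
Lemma antiderivative (R : realType) (m n : nat) (h : R -> 'M[R]_(m, n)) (a : R) :
  continuous h -> exists H : R -> 'M[R]_(m, n), forall t, a < t -> is_derive t 1 H (h t).
Proof.
move=> hc.
pose H t := \matrix_(i, j) \int[lebesgue_measure]_(s in `[a, t]) (h s i j).
exists H => t ta; apply: is_derive_mx => i j.
have hijc : continuous (fun s => h s i j).
  by move=> s; apply: (@continuous_comp _ _ _ h (fun M => M i j)); [exact: hc|exact: coord_continuous].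
have [||||dF F'] := @continuous_FTC1_closed R (fun s => h s i j) a t (t + 1).
- by rewrite ltrDl.
- apply: continuous_compact_integrable; first exact: segment_compact.
  by apply: continuous_subspaceT.
- by [].
- exact: hijc.
rewrite [X in is_derive _ _ X _](_ : _ =
  fun x => \int[lebesgue_measure]_(s in `[a, x]) (h s i j)); last first.
  by apply/funext => s; rewrite mxE.
apply: DeriveDef; [exact: dF|rewrite -derive1E; exact: F'].
Qed.

(** For 0 <= r, the nearest-point projection of the line onto [-r, r]; it truncates times as well as
    coordinates of points. *)
Definition clamp (R : realType) (r t : R) : R := Num.max (- r) (Num.min r t).

Lemma clamp_norm (R : realType) (r t : R) : 0 <= r -> `|clamp r t| <= r.
Proof.
move=> r0; rewrite ler_norml /clamp le_max lexx/= ge_max ge_min lexx/= andbT.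
lra.
Qed.

Lemma clamp_id (R : realType) (r t : R) : `|t| <= r -> clamp r t = t.
Proof. by rewrite ler_norml /clamp => /andP[? ?]; rewrite min_r// max_r. Qed.

Lemma clamp_lipschitz (R : realType) (r s t : R) :
  0 <= r -> `|clamp r s - clamp r t| <= `|s - t|.
Proof.
move=> r0; wlog st : s t / s <= t.
  by move=> H; have [/H//|/ltW/H] := leP s t; rewrite distrC (distrC t).
rewrite distrC (distrC s) [leRHS]ger0_norm ?subr_ge0//.
rewrite ler_norml /clamp; have [?|?] := leP r s; have [?|?] := leP r t.
- lra.
- lra.
- by have [?|?] := leP (- r) r; have [?|?] := leP (- r) s; lra.
- by have [?|?] := leP (- r) t; have [?|?] := leP (- r) s; lra.
Qed.

(* Picard iterates are built on all of R: each curve is frozen outside [-T, T] by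
   composing it with [clamp T], so that sup bounds over R make sense. *)
Lemma picard_lindelof (R : realType) (n : nat) (F : 'rV[R]_n -> 'rV[R]_n)
    (L T : R) (p : 'rV[R]_n) :
  0 <= L -> (forall u v, `|F u - F v| <= L * `|u - v|) -> 0 < T -> L * T <= 2^-1 ->
  exists z v : R -> 'rV[R]_n, [/\ z 0 = p, continuous v,
    forall t, - (2 * T) < t -> is_derive t 1 z (v t)
    & forall t, `|t| <= T -> v t = F (z t)].
Proof.
move=> L0 FL T0 LT.
have Fc : continuous F by apply: lipschitz_continuous_global FL.
(* The Picard operator: p plus the integral of F along Y from 0. Its value at a discontinuous Y is
   arbitrary. *)
have /choice[op opP] : forall Y : R -> 'rV[R]_n, exists H : R -> 'rV[R]_n,
    continuous Y -> H 0 = p /\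
    forall t, - (2 * T) < t -> is_derive t 1 H (F (Y t)).
  move=> Y; have [Yc|] := pselect (continuous Y); last by exists Y.
  have [|H HE] := @antiderivative _ _ _ (F \o Y) (- (2 * T)).
    by move=> t; apply: continuous_comp; [exact: Yc|exact: Fc].
  exists (fun t => H t - (H 0 - p)) => _; split; first by rewrite subKr.
  move=> t /HE Ht; rewrite -[F (Y t)]subr0.
  by apply: is_deriveB; exact: is_derive_cst.
have T2 t : `|t| <= T -> - (2 * T) < t by rewrite ler_norml; lra.
pose nxt Y := op Y \o clamp T.
have nxtc Y : continuous Y -> continuous (nxt Y).
  move=> /opP[_ opd] t; apply: continuous_comp.
    by apply: (@lipschitz_continuous_global _ _ _ _ 1) => u v;
      rewrite mul1r clamp_lipschitz// ltW.
  by apply: is_derive_continuous; apply: opd; apply: T2; rewrite clamp_norm// ltW.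
(* On [-T, T] the operator halves sup distances, because L T <= 1/2. *)
have opdist Y Y' d t : continuous Y -> continuous Y' ->
    (forall s, `|Y s - Y' s| <= d) -> `|t| <= T -> `|op Y t - op Y' t| <= d / 2.
  move=> Yc Y'c Yd tT; have [op0 opd] := opP _ Yc; have [op'0 op'd] := opP _ Y'c.
  have d0 : 0 <= d by apply: le_trans (Yd 0).
  have := @mean_value_inequality_sym _ _ _ (op Y - op Y')
    (fun s => F (Y s) - F (Y' s)) t (L * d).
  rewrite /= !fctE op0 op'0 subrr subr0 => H.
  apply: (@le_trans _ _ (L * d * `|t|)).
    apply: H => s st.
      by apply: is_deriveB; [apply: opd|apply: op'd]; apply: T2; exact: le_trans tT.
    by rewrite (le_trans (FL _ _))// ler_wpM2l.
  rewrite mulrAC mulrC ler_wpM2l// (le_trans _ LT)// ler_wpM2l//.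
pose Y k := iter k nxt (cst p).
have Yc k : continuous (Y k).
  by elim: k => [|k IH]; [exact: cst_continuous|exact: nxtc].
pose C := `|F p| * T.
have YC k t : `|Y k.+1 t - Y k t| <= C / 2 ^+ k.
  elim: k t => [|k IH] t.
    have [op0 opd] := opP _ (Yc 0%N).
    rewrite expr0 divr1 /= /nxt /=.
    rewrite -[X in _ - X]op0.
    have ct : `|clamp T t| <= T by rewrite clamp_norm// ltW.
    apply: (@le_trans _ _ (`|F p| * `|clamp T t|)); last by rewrite ler_wpM2l.
    apply: (@mean_value_inequality_sym _ _ _ (op (cst p)) (fun=> F p)) => // s st.
    by apply: (opd s); apply: T2; exact: le_trans ct.
  rewrite exprSr invfM mulrA; apply: opdist; [exact: (Yc k.+1)|exact: Yc|exact: IH|].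
  by rewrite clamp_norm// ltW.
have /choice[Z ZY] : forall t, exists l, forall k, `|l - Y k t| <= C / 2 ^+ k *+ 2.
  by move=> t; apply: geometric_cvg => k; exact: YC.
have Zc : continuous Z.
  move=> t; apply/cvgrPdist_lt => e e0.
  have [k Ck] := half_pow_small (C *+ 2) (divr_gt0 e0 (ltr0n R 3)).
  have YZ s : `|Z s - Y k s| < e / 3 by apply: le_lt_trans Ck; rewrite mulrnAl.
  near=> s.
  have -> : Z t - Z s = (Z t - Y k t) + ((Y k t - Y k s) + (Y k s - Z s)).
    by rewrite !subrKA.
  have -> : e = e / 3 + (e / 3 + e / 3) by field.
  rewrite (le_lt_trans (ler_normD _ _))// ltrD//.
  rewrite (le_lt_trans (ler_normD _ _))// ltrD//; last by rewrite distrC.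
  by near: s; apply: (@cvgr_dist_lt _ _ _ _ _ (Y k)); [exact: Yc|rewrite divr_gt0].
(* The limit Z is constant on each side of [-T, T], hence possibly not differentiable at T and -T.
   The solution is therefore [op Z], which agrees with Z on [-T, T]. *)
exists (op Z), (F \o Z); have [op0 opd] := opP _ Zc; split => //.
- by move=> t; apply: continuous_comp; [exact: Zc|exact: Fc].
- move=> t tT /=; congr F; apply/eqP; rewrite -subr_eq0 -normr_le0.
  apply/ler_addgt0Pr => e e0; rewrite add0r.
  have [k Ck] := half_pow_small (C *+ 2) e0.
  apply: ltW; apply: le_lt_trans Ck.
  rewrite -(subrKA (Y k.+1 t)) (le_trans (ler_normD _ _))//.
  rewrite [leRHS]splitr; apply: lerD.
    by apply: (le_trans (ZY t _)); rewrite exprSr invfM mulrA !mulrnAl.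
  have -> : Y k.+1 t = op (Y k) t by rewrite /Y iterS /nxt /= clamp_id.
  by apply: opdist; [exact: Yc|exact: Zc|move=> s; rewrite distrC mulrnAl|].
Unshelve. all: by end_near. Qed.

Lemma is_derive_line (R : realType) (U V : normedModType R) (f : U -> V) (b d : U)
    (t : R) : differentiable f (t *: d + b) ->
  is_derive t 1 (fun s : R => f (s *: d + b)) ('d f (t *: d + b) d).
Proof.
move=> df; have fE : (fun h : R => h^-1 *: ((f \o shift (t *: d + b)) (h *: d) - f (t *: d + b))) =
    (fun h : R => h^-1 *: (((fun s : R => f (s *: d + b)) \o shift t) (h *: 1) - f (t *: d + b))).
  by apply/funext => h /=; rewrite scaler1 scalerDl addrA.
apply: DeriveDef.
  have := @diff_derivable _ _ _ _ _ d df.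
  by rewrite /derivable fE.
by rewrite -(deriveE d df) /derive fE.
Qed.

Lemma is_derive_scalel (R : realType) (V : normedModType R) (w : V) (t : R) :
  is_derive t 1 (fun s : R => s *: w) w.
Proof.
rewrite (_ : (fun s : R => s *: w) = fun s => idfun (s *: w + 0)); last first.
  by apply/funext => s /=; rewrite addr0.
have [d dE] := is_diff_id (t *: w + 0).
by have := is_derive_line d; rewrite dE.
Qed.

(** Along the segment from b to a, f minus its linear part at x0 has derivative (a - b) (J(c) -
    J(x0)), with c on the segment, and this is small by continuity of the Jacobian J. *)
Lemma C1_field_strict (R : realType) (n : nat) (f : 'rV[R]_n -> 'rV[R]_n)
    (x0 : 'rV[R]_n) (eta : R) : C1_field f -> 0 < eta ->
  exists2 r, 0 < r & forall a b, `|a - x0| <= r -> `|b - x0| <= r ->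
    `|f a - f b - (a - b) *m jacobian f x0| <= eta * `|a - b|.
Proof.
move=> [df Jf] eta0.
(* Multiplying by a matrix costs a factor n in the sup norm; the [+ 1] keeps the divisor positive
   when n = 0. *)
have n0 : 0 < n%:R + 1 :> R by rewrite ltr_wpDl.
have /cvgrPdist_lt /(_ _ (divr_gt0 eta0 n0)) := Jf x0.
rewrite -filter_from_ballE => -[d /= d0 Jd].
exists (d / 2); first by rewrite divr_gt0.
move=> a b ad bd.
pose g (t : R) := f (t *: (a - b) + b) - t *: ((a - b) *m jacobian f x0).
have -> : f a - f b - (a - b) *m jacobian f x0 = g 1 - g 0.
  by rewrite /g !scale1r !scale0r subrK add0r subr0 addrAC.
rewrite -[leRHS]mulr1 -[X in _ * X]subr0.
apply: (@mean_value_inequality _ _ _ g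
  (fun t => (a - b) *m (jacobian f (t *: (a - b) + b) - jacobian f x0))) => // t t01.
  rewrite mulmxBr; apply: is_deriveB.
    by rewrite /jacobian mul_rV_lin1; exact: is_derive_line.
  exact: is_derive_scalel.
have ct : `|t *: (a - b) + b - x0| < d.
  have -> : t *: (a - b) + b - x0 = t *: (a - x0) + (1 - t) *: (b - x0).
    by apply/rowP => i; rewrite !mxE; ring.
  rewrite (le_lt_trans (ler_normD _ _))// !mx_normZ.
  move/andP : t01 => [t0 t1]; rewrite !ger0_norm ?subr_ge0//.
  apply: (@le_lt_trans _ _ (d / 2)); last by lra.
  by nra.
rewrite (le_trans (mulmx_norm_le _ _))// ler_wpM2r//.
have {}Jd : `|jacobian f (t *: (a - b) + b) - jacobian f x0| <= eta / (n%:R + 1).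
  by rewrite distrC ltW//; apply: Jd; rewrite -ball_normE /= distrC.
apply: (@le_trans _ _ ((n%:R + 1) * (eta / (n%:R + 1)))).
  by apply: ler_pM => //; rewrite lerDl.
by rewrite mulrC divfK// gt_eqF.
Qed.

(** The orbit of x0 stays in the ball: G x0 is within rho / 2 of x0, and the next iterate is within
    rho / 2 of G x0 by contraction. *)
Lemma contraction_fixed_point (R : realType) (n : nat) (G : 'rV[R]_n -> 'rV[R]_n)
    (x0 : 'rV[R]_n) (rho : R) :
  (forall p q, `|p - x0| <= rho -> `|q - x0| <= rho ->
    `|G p - G q| <= `|p - q| / 2) ->
  `|G x0 - x0| <= rho / 2 ->
  exists2 p, `|p - x0| <= rho & G p = p.
Proof.
move=> GG Gx0; pose u k := iter k G x0.
have rho0 : 0 <= rho by have := le_trans (normr_ge0 _) Gx0; lra.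
have ux0 k : `|u k - x0| <= rho.
  elim: k => [|k IH]; first by rewrite subrr normr0.
  rewrite -(subrKA (G x0)) (le_trans (ler_normD _ _))// [leRHS]splitr lerD//.
  by rewrite (le_trans (GG _ _ _ _))// ?subrr ?normr0// ler_wpM2r.
have uu k : `|u k.+1 - u k| <= rho / 2 / 2 ^+ k.
  elim: k => [|k IH]; first by rewrite expr0 divr1.
  rewrite exprSr invfM mulrA.
  by apply: (le_trans (GG _ _ (ux0 k.+1) (ux0 k))); rewrite ler_wpM2r.
have [l ul] := geometric_cvg uu.
have lx0 : `|l - x0| <= rho by have := ul 0%N; rewrite expr0 divr1; lra.
exists l => //; apply/eqP; rewrite -subr_eq0 -normr_le0.
apply/ler_addgt0Pr => e e0; rewrite add0r.
have [k /ltW ke] := half_pow_small (rho *+ 2) e0.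
rewrite -(subrKA (u k.+1)) (le_trans (ler_normD _ _))//; apply: (le_trans _ ke).
rewrite [leRHS]splitr lerD//.
  apply: (le_trans (GG _ _ lx0 (ux0 k))); rewrite ler_wpM2r//.
  apply: (le_trans (ul k)); rewrite mulrnAl ler_wMn2r// ler_wpM2r//; lra.
have w0 : 0 <= rho / 2 ^+ k by rewrite divr_ge0// exprn_ge0.
rewrite distrC; apply: (le_trans (ul k.+1)); rewrite exprS invfM; lra.
Qed.

(** A curve started in the half ball travels at most M T <= r / 2, so it stays in the ball of radius
    r, where the truncated field is f itself. *)
Lemma local_flow (R : realType) (n : nat) (f : 'rV[R]_n -> 'rV[R]_n)
    (x0 : 'rV[R]_n) (r L M T : R) : 0 <= r -> 0 <= L -> 0 < T ->
  L * T <= 2^-1 -> M * T <= r / 2 ->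
  (forall a b, `|a - x0| <= r -> `|b - x0| <= r -> `|f a - f b| <= L * `|a - b|) ->
  (forall a, `|a - x0| <= r -> `|f a| <= M) ->
  forall p, `|p - x0| <= r / 2 ->
  exists z v : R -> 'rV[R]_n, [/\ z 0 = p, continuous v,
    forall t, - (2 * T) < t -> is_derive t 1 z (v t)
    & forall t, `|t| <= T ->
      [/\ v t = f (z t), `|z t - p| <= M * `|t| & `|z t - x0| <= r]].
Proof.
move=> r0 L0 T0 LT MT fL fM p px0.
(* The retraction onto the sup-norm ball of radius r around x0: it is
   1-Lipschitz, so that [f \o rho] is globally Lipschitz. *)
pose rho (u : 'rV[R]_n) : 'rV[R]_n := \row_i (x0 0 i + clamp r (u 0 i - x0 0 i)).
have rhoB u : `|rho u - x0| <= r.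
  by apply/mx_norm_leP => // i j; rewrite !mxE (ord1 i) addrAC subrr add0r clamp_norm.
have rhoid u : `|u - x0| <= r -> rho u = u.
  move=> ur; apply/rowP => i; rewrite !mxE clamp_id ?subrKC//.
  by move/(mx_norm_leP _ r0) : ur => /(_ 0 i); rewrite !mxE.
have rhoL u v : `|rho u - rho v| <= `|u - v|.
  apply/mx_norm_leP => // i j; rewrite !mxE opprD addrACA subrr add0r.
  rewrite (le_trans (clamp_lipschitz _ _ r0))//.
  rewrite opprB addrA subrK.
  by have := coord_norm_le (u - v) 0 j; rewrite !mxE.
have [||z [v [z0 vc zE vE]]] := @picard_lindelof _ _ (f \o rho) L T p _ _ T0 LT.
- exact: L0.
- by move=> u v; rewrite (le_trans (fL _ _ _ _))// ler_wpM2l.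
exists z, v; split => // t tT.
(* The truncated field is bounded by M everywhere, so this distance is controlled before z is known
   to stay in the ball. *)
have zp : `|z t - p| <= M * `|t|.
  rewrite -z0; apply: (@mean_value_inequality_sym _ _ _ z v) => s st.
    by apply: zE; have := le_trans st tT; rewrite ler_norml; lra.
  by rewrite vE ?(le_trans st)//; exact: fM.
have zr : `|z t - x0| <= r.
  rewrite -(subrKA p) (le_trans (ler_normD _ _))// [leRHS]splitr lerD//.
  rewrite (le_trans zp)// (le_trans _ MT)// ler_wpM2l//.
  by apply: le_trans (fM x0 _); rewrite ?subrr ?normr0.
by split => //; rewrite vE//= rhoid.
Qed.

(** * Dependence of local solutions on the initial point *)

Section Flow_estimates.
Context {R : realType} {n : nat}.
Variables (f : 'rV[R]_n -> 'rV[R]_n) (J : 'M[R]_n) (x0 : 'rV[R]_n) (r eta L M T : R).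
Hypothesis fJ : forall a b, `|a - x0| <= r -> `|b - x0| <= r ->
  `|f a - f b - (a - b) *m J| <= eta * `|a - b|.
Hypothesis eta_ge0 : 0 <= eta.
Hypothesis etaJL : eta + n%:R * `|J| <= L.

Let L0 : 0 <= L.
Proof. by apply: le_trans etaJL; rewrite addr_ge0// mulr_ge0. Qed.

Lemma lipschitz_of_strict a b : `|a - x0| <= r -> `|b - x0| <= r ->
  `|f a - f b| <= L * `|a - b|.
Proof.
move=> ar br; rewrite -[f a - f b](subrK ((a - b) *m J)).
rewrite (le_trans (ler_normD _ _))// (le_trans (lerD (fJ ar br) (mulmx_norm_le _ _)))//.
by rewrite -mulrDl ler_wpM2r.
Qed.

(* The bound [- (2 * T) < t] leaves z differentiable on a neighborhood of
   [-T, T]; outside [-T, T], v is unrelated to f. *)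
Definition flow_at (p : 'rV[R]_n) (z v : R -> 'rV[R]_n) := [/\ z 0 = p, continuous v,
  forall t, - (2 * T) < t -> is_derive t 1 z (v t)
  & forall t, `|t| <= T ->
      [/\ v t = f (z t), `|z t - p| <= M * `|t| & `|z t - x0| <= r]].

Hypothesis T0 : 0 < T.
Let T2 (t : R) : `|t| <= T -> - (2 * T) < t.
Proof. by move: T0; rewrite ler_norml; lra. Qed.

Hypothesis LT : L * T <= 2^-1.

(** At time s the curve is within M |s| of p, so its velocity is within L M |s| of f p. Used at p =
    x0 to bound W(x0). *)
Lemma flow_at_consistency p z v t : flow_at p z v -> 0 <= M -> `|p - x0| <= r ->
  `|t| <= T -> `|z t - p - t *: f p| <= L * M * `|t| ^+ 2.
Proof.
move=> [z0 _ zE vE] M0 pr tT.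
have := @mean_value_inequality_sym _ _ _ (fun s => z s - s *: f p)
  (fun s => v s - f p) t (L * M * `|t|).
rewrite z0 scale0r subr0 addrAC expr2 mulrA; apply => s st.
  apply: is_deriveB; last exact: is_derive_scalel.
  by apply: zE; apply: T2; exact: le_trans tT.
have [-> zp zr] := vE _ (le_trans st tT).
rewrite (le_trans (lipschitz_of_strict _ _))// -mulrA ler_wpM2l//.
by rewrite (le_trans zp)// ler_wpM2l.
Qed.

Hypothesis LLT : L * (L * T) <= eta.

(** This plays the role of Gronwall's inequality. At the time c of [-T, T] where |z - y| is largest,
    z - y has moved away from p - q by at most L T times that maximum, that is, by at most half of
    it. *)
Lemma flow_at_dist p q z v y w t : flow_at p z v -> flow_at q y w -> `|t| <= T ->
  `|z t - y t| <= 2 * `|p - q|.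
Proof.
move=> [z0 _ zE vE] [y0 _ yE wE].
have [||c cT cmax] := @EVT_max _ (fun s => `|z s - y s|) (- T) T.
- by rewrite ge0_cp// ltW.
- apply: continuous_in_subspaceT => s; rewrite inE/= in_itv/= -ler_norml => sT.
  apply: (@continuous_comp _ _ _ (fun s => z s - y s) Num.Def.normr); last exact: norm_continuous.
  by apply: is_derive_continuous; apply: is_deriveB; [apply: zE|apply: yE]; exact: T2.
move: cT; rewrite in_itv/= -ler_norml => cT.
have cpq : `|z c - y c - (p - q)| <= `|z c - y c| / 2.
  have := @mean_value_inequality_sym _ _ _ (fun s => z s - y s)
    (fun s => v s - w s) c (L * `|z c - y c|).
  rewrite z0 y0 => H; rewrite (le_trans (H _ _))//.
  - by move=> s sc; apply: is_deriveB; [apply: zE|apply: yE]; apply: T2; exact: le_trans cT.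
  - move=> s sc; have sT := le_trans sc cT.
    have [-> _ zr] := vE _ sT; have [-> _ yr] := wE _ sT.
    rewrite (le_trans (lipschitz_of_strict _ _))// ler_wpM2l//.
    by apply: cmax; rewrite in_itv/= -ler_norml.
  - rewrite mulrAC mulrC ler_wpM2l// (le_trans _ LT)// ler_wpM2l//.
have : `|z c - y c| <= `|z c - y c - (p - q)| + `|p - q|.
  by rewrite -{1}[z c - y c](subrK (p - q)) ler_normD.
move=> cpq' tT; have : `|z t - y t| <= `|z c - y c|.
  by apply: cmax; rewrite in_itv/= -ler_norml.
lra.
Qed.

(** The quantity inside the norm has derivative (f z - f y - (z - y) J) + (z - y - (p - q)) J. The
    first term is at most 2 eta |p - q| by strict differentiability, the second at most L (2 L T |p
    - q|), which is again at most 2 eta |p - q| because L (L T) <= eta. *)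
Lemma flow_at_strict p q z v y w t : flow_at p z v -> flow_at q y w -> `|t| <= T ->
  `|z t - y t - (p - q) - t *: ((p - q) *m J)| <= 4 * eta * `|p - q| * `|t|.
Proof.
move=> zv yw; have D := flow_at_dist zv yw.
case: zv yw => [z0 _ zE vE] [y0 _ yE wE] tT.
have D1 s : `|s| <= T -> `|z s - y s - (p - q)| <= 2 * L * T * `|p - q|.
  move=> sT.
  have := @mean_value_inequality_sym _ _ _ (fun s => z s - y s)
    (fun s => v s - w s) s (L * (2 * `|p - q|)).
  rewrite z0 y0 => H; rewrite (le_trans (H _ _))//.
  - move=> u us; have uT := le_trans us sT.
    by apply: is_deriveB; [apply: zE|apply: yE]; exact: T2.
  - move=> u us; have uT := le_trans us sT.
    have [-> _ zr] := vE _ uT; have [-> _ yr] := wE _ uT.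
    rewrite (le_trans (lipschitz_of_strict _ _))// ler_wpM2l//.
    exact: D.
  - rewrite [leRHS](_ : _ = L * (2 * `|p - q|) * T); last by ring.
    by rewrite ler_wpM2l// !mulr_ge0.
have := @mean_value_inequality_sym _ _ _ (fun s => z s - y s - s *: ((p - q) *m J))
  (fun s => v s - w s - (p - q) *m J) t (4 * eta * `|p - q|).
rewrite z0 y0 scale0r subr0 addrAC; apply => s st.
  apply: is_deriveB; last exact: is_derive_scalel.
  by apply: is_deriveB; [apply: zE|apply: yE]; apply: T2; exact: le_trans tT.
have sT := le_trans st tT.
have [-> _ zr] := vE _ sT; have [-> _ yr] := wE _ sT.
have -> : f (z s) - f (y s) - (p - q) *m J =
    (f (z s) - f (y s) - (z s - y s) *m J) + (z s - y s - (p - q)) *m J.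
  by rewrite [(_ - (p - q)) *m J]mulmxBl addrA subrK.
rewrite (le_trans (ler_normD _ _))// (le_trans (lerD (fJ zr yr) (mulmx_norm_le _ _)))//.
have H1 : eta * `|z s - y s| <= eta * (2 * `|p - q|) by rewrite ler_wpM2l// D.
have H2 : n%:R * `|J| * `|z s - y s - (p - q)| <= L * (2 * L * T * `|p - q|).
  rewrite ler_pM ?mulr_ge0//; last exact: D1.
  by apply: le_trans etaJL; rewrite lerDr.
have H3 : L * (2 * L * T * `|p - q|) <= 2 * eta * `|p - q|.
  rewrite [leLHS](_ : _ = 2 * (L * (L * T)) * `|p - q|); last by ring.
  by rewrite ler_wpM2r// ler_wpM2l.
lra.
Qed.

End Flow_estimates.

(** * Concatenation of arcs *)

Section Solution_segments.
Context {R : realType} {n : nat}.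
Implicit Types (x g v : R -> 'rV[R]_n) (f : 'rV[R]_n -> 'rV[R]_n) (a b t : R).

(** A periodic curve has corners at its switching times. Comparing x with a curve g that is
    differentiable on both sides even at a and b yields the one-sided derivatives of x there; v,
    continuous on the whole line, is the velocity required by [C1_on_segment]. *)
Definition solution_segment f x a b := exists g v, [/\ continuous v,
  forall t, a <= t <= b -> x t = g t,
  forall t, a <= t <= b -> is_derive t 1 g (v t)
  & forall t, a <= t <= b -> v t = f (x t)].

Lemma is_derive_translate g t c (dg : 'rV[R]_n) :
  is_derive (t - c) 1 g dg -> is_derive t 1 (fun s => g (s - c)) dg.
Proof.
move=> [gt <-].
have gE : (fun h : R => h^-1 *: ((g \o shift (t - c)) (h *: 1) - g (t - c))) =
    (fun h : R => h^-1 *: (((fun s => g (s - c)) \o shift t) (h *: 1) - g (t - c))).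
  by apply/funext => h /=; rewrite addrA.
apply: DeriveDef; first by move: gt; rewrite /derivable gE.
by rewrite /derive gE.
Qed.

Lemma is_derive_cvg g t (dg : 'rV[R]_n) : is_derive t 1 g dg ->
  h^-1 *: (g (t + h) - g t) @[h --> 0^'] --> dg.
Proof.
move=> [gt <-]; move: gt; rewrite /derivable /derive.
rewrite (_ : (fun h : R => h^-1 *: ((g \o shift t) (h *: 1) - g t)) =
  (fun h : R => h^-1 *: (g (t + h) - g t))) //.
by apply/funext => h /=; rewrite [h *: 1]mulr1 (addrC h).
Qed.

Lemma segment_right_derivative f x a b t : solution_segment f x a b ->
  a <= t < b -> right_derivative x t (f (x t)).
Proof.
move=> [g [v [_ xg gE vE]]] /andP[at_ tb].
have tab : a <= t <= b by rewrite at_ ltW.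
rewrite /right_derivative -vE//.
apply: cvg_trans (cvg_dnbhs_at_right (is_derive_cvg (gE _ tab))).
apply: near_eq_cvg; near=> h.
rewrite !xg//; apply/andP; split.
  by rewrite (le_trans at_)// lerDl; near: h; exact: nbhs_right_ge.
by rewrite -lerBrDl; near: h; apply: nbhs_right_le; rewrite subr_gt0.
Unshelve. all: by end_near. Qed.

Lemma segment_left_derivative f x a b t : solution_segment f x a b ->
  a < t <= b -> left_derivative x t (f (x t)).
Proof.
move=> [g [v [_ xg gE vE]]] /andP[at_ tb].
have tab : a <= t <= b by rewrite tb ltW.
rewrite /left_derivative -vE//.
apply: cvg_trans (cvg_dnbhs_at_left (is_derive_cvg (gE _ tab))).
apply: near_eq_cvg; near=> h.
rewrite !xg//; apply/andP; split; last first.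
  by rewrite (le_trans _ tb)// gerDl; near: h; exact: nbhs_left_le.
by rewrite -lerBlDl; near: h; apply: nbhs_left_ge; rewrite subr_lt0.
Unshelve. all: by end_near. Qed.

Lemma segment_is_derive f x a b t : solution_segment f x a b ->
  a < t < b -> is_derive t 1 x (f (x t)).
Proof.
move=> [g [v [_ xg gE vE]]] tab.
have tab' : a <= t <= b by case/andP: tab => ? ?; rewrite !ltW.
rewrite -vE//; apply: near_eq_is_derive (gE _ tab').
near=> s; apply/esym; apply: xg.
suff : s \in `]a, b[ by rewrite in_itv/= => /andP[? ?]; rewrite !ltW.
by near: s; apply: near_in_itvoo; rewrite in_itv.
Unshelve. all: by end_near. Qed.

Lemma segment_right_cvg f x a b t : solution_segment f x a b ->
  a <= t < b -> x s @[s --> t^'+] --> x t.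
Proof.
move=> [g [v [_ xg gE vE]]] /andP[at_ tb].
have tab : a <= t <= b by rewrite at_ ltW.
rewrite [x t]xg//.
apply: cvg_trans (cvg_at_right_filter (is_derive_continuous (gE _ tab))).
apply: near_eq_cvg; near=> s.
rewrite xg//; apply/andP; split.
  by rewrite (le_trans at_)//; near: s; exact: nbhs_right_ge.
by near: s; exact: nbhs_right_le.
Unshelve. all: by end_near. Qed.

Lemma segment_left_cvg f x a b t : solution_segment f x a b ->
  a < t <= b -> x s @[s --> t^'-] --> x t.
Proof.
move=> [g [v [_ xg gE vE]]] /andP[at_ tb].
have tab : a <= t <= b by rewrite tb ltW.
rewrite [x t]xg//.
apply: cvg_trans (cvg_at_left_filter (is_derive_continuous (gE _ tab))).
apply: near_eq_cvg; near=> s.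
rewrite xg//; apply/andP; split; last first.
  by rewrite (le_trans _ tb)//; near: s; exact: nbhs_left_le.
by near: s; exact: nbhs_left_ge.
Unshelve. all: by end_near. Qed.

(** Passing to a subsegment is essential: the ends of the interval in [piecewise_C1] are arbitrary
    and may fall inside an arc. *)
Lemma segment_C1 f x a b a' b' : solution_segment f x a b ->
  a <= a' -> a' < b' -> b' <= b -> C1_on_segment x a' b'.
Proof.
move=> xab aa' ab' bb'; have [g [v [vc xg gE vE]]] := xab.
exists v; split.
- exact: continuous_subspaceT.
- rewrite vE ?aa'/=; last by rewrite (le_trans (ltW ab')).
  by apply: segment_right_derivative xab _; rewrite aa' (lt_le_trans ab').
- move=> t /andP[a't tb']; have at_ := le_lt_trans aa' a't.
  have tb := lt_le_trans tb' bb'.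
  by rewrite vE ?ltW//; apply: segment_is_derive xab _; rewrite at_ tb.
- rewrite vE ?bb' ?andbT; last by rewrite (le_trans aa')// ltW.
  by apply: segment_left_derivative xab _; rewrite bb' (le_lt_trans aa').
Qed.

Definition piecewise_C1_on x a b := exists2 s : seq R, itv_partition a b s &
  forall i : nat, (i < size s)%N ->
    C1_on_segment x (nth b (a :: s) i) (nth b (a :: s) i.+1).

Lemma piecewise_C1_on1 x a b : a < b -> C1_on_segment x a b -> piecewise_C1_on x a b.
Proof.
move=> ab xab; exists [:: b]; first exact: itv_partition1.
by case=> [_|i]; [exact: xab|rewrite ltnS ltn0].
Qed.

Lemma piecewise_C1_on_cat x a b c :
  piecewise_C1_on x a b -> piecewise_C1_on x b c -> piecewise_C1_on x a c.
Proof.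
move=> [s sab xs] [r rbc xr]; exists (s ++ r); first exact: itv_partition_cat sab rbc.
move=> i; rewrite size_cat => isr.
have [is_|si] := ltnP i (size s).
  have -> : nth c (a :: s ++ r) i = nth b (a :: s) i.
    by rewrite -cat_cons nth_cat /= ltnS ltnW//; apply: set_nth_default; rewrite /= ltnS ltnW.
  rewrite [nth c _ _](_ : _ = nth b (a :: s) i.+1); first exact: xs.
  by rewrite /= nth_cat is_; exact: set_nth_default.
have ir : (i - size s < size r)%N by rewrite ltn_subLR.
have -> : nth c (a :: s ++ r) i.+1 = nth c (b :: r) (i - size s).+1.
  by rewrite /= nth_cat ltnNge si.
have -> : nth c (a :: s ++ r) i = nth c (b :: r) (i - size s)%N; last exact: xr.
have bE := itv_partition_nth_size c sab.
(* At the junction, index [size s] of the joined list is the last point of [a :: s], namely b, which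
   is also the head of [b :: r]. *)
have [->|sni] := eqVneq i (size s).
  by rewrite subnn /= -cat_cons nth_cat /= ltnSn bE.
have lsi : (size s < i)%N by rewrite ltn_neqAle eq_sym sni.
rewrite -cat_cons nth_cat /= ltnS leqNgt lsi /=.
by rewrite -[in RHS](subnSK lsi).
Qed.

End Solution_segments.

Section Gluing.
Context {R : realType} {n : nat}.
Variables (f1 f2 : 'rV[R]_n -> 'rV[R]_n) (kappa d : R).
Hypotheses (kappa_gt0 : 0 < kappa) (kappa_lt : kappa < d).

Let d_gt0 : 0 < d. Proof. exact: lt_trans kappa_lt. Qed.

Lemma period_index (t : R) : exists k : int, k%:~R * d <= t < (k + 1)%:~R * d.
Proof.
exists (Num.floor (t / d)).
by rewrite -ler_pdivlMr// -ltr_pdivrMr// floor_itv.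
Qed.

Let period_end (k : int) : (k + 1)%:~R * d = k%:~R * d + d.
Proof. by rewrite intrD mulrDl mul1r. Qed.

Lemma two_cycle_of_segments (x : R -> 'rV[R]_n) : periodic x d ->
  (forall k : int, solution_segment f1 x (k%:~R * d) (k%:~R * d + kappa)) ->
  (forall k : int, solution_segment f2 x (k%:~R * d + kappa) ((k + 1)%:~R * d)) ->
  two_cycle f1 f2 x.
Proof.
move=> xd S1 S2.
have right t : exists f, [/\ f = f1 \/ f = f2,
    right_derivative x t (f (x t)) & x s @[s --> t^'+] --> x t].
  have [k /andP[kt tk]] := period_index t.
  have [tkk|kkt] := ltP t (k%:~R * d + kappa).
    have tk' : k%:~R * d <= t < k%:~R * d + kappa by rewrite kt.
    exists f1; split; first by left.
    - exact: segment_right_derivative (S1 k) tk'.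
    - exact: segment_right_cvg (S1 k) tk'.
  have tk' : k%:~R * d + kappa <= t < (k + 1)%:~R * d by rewrite kkt.
  exists f2; split; first by right.
  - exact: segment_right_derivative (S2 k) tk'.
  - exact: segment_right_cvg (S2 k) tk'.
have left t : x s @[s --> t^'-] --> x t.
  have [k /andP[kt tk]] := period_index t.
  have [tkk|kkt] := leP t (k%:~R * d + kappa); last first.
    by apply: segment_left_cvg (S2 k) _; rewrite kkt ltW.
  move: kt; rewrite le_eqVlt => /predU1P[<-|kt]; last first.
    by apply: segment_left_cvg (S1 k) _; rewrite kt.
  (* At t = k d the curve arrives along the f2 arc of the preceding period. *)
  have := S2 (k - 1); rewrite subrK => S2k.
  apply: segment_left_cvg S2k _; rewrite lexx andbT -[X in _ < X%:~R * d](subrK 1).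
  by rewrite period_end ltrD2l.
split; last first.
  exists d, kappa; split => //; first by rewrite kappa_gt0.
  - have := S1 0; rewrite mul0r add0r => S10; split.
      by apply: segment_right_derivative S10 _; rewrite lexx.
    by move=> t; exact: segment_is_derive S10.
  - have := S2 0; rewrite mul0r !add0r mul1r => S20; split.
      by apply: segment_right_derivative S20 _; rewrite lexx.
    by move=> t; exact: segment_is_derive S20.
split.
- move=> t; apply/left_right_continuousP; split; first exact: left.
  by have [f []] := right t.
- have one k a b : k%:~R * d <= a -> a < b -> b <= (k + 1)%:~R * d ->
      piecewise_C1_on x a b.
    move=> ka ab bk.
    have [bkk|kkb] := leP b (k%:~R * d + kappa).
      by apply: piecewise_C1_on1 => //; exact: segment_C1 (S1 k) _ _ _.
    have [kka|akk] := leP (k%:~R * d + kappa) a.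
      by apply: piecewise_C1_on1 => //; exact: segment_C1 (S2 k) _ _ _.
    apply: (@piecewise_C1_on_cat _ _ _ _ (k%:~R * d + kappa)).
      by apply: piecewise_C1_on1 => //; exact: segment_C1 (S1 k) _ _ _.
    by apply: piecewise_C1_on1 => //; exact: segment_C1 (S2 k) _ _ _.
  (* Induction on the number of periods covered; [one] treats an interval inside one period, cut at
     the switching time if it contains it. *)
  have many (k : int) (N : nat) a b : k%:~R * d <= a -> a < b ->
      b <= (k + N%:Z)%:~R * d -> piecewise_C1_on x a b.
    elim: N a b => [|N IH] a b ka ab.
      by rewrite addr0 => /(lt_le_trans ab)/(le_lt_trans ka); rewrite ltxx.
    rewrite -addn1 PoszD addrA => bN.
    have [bN'|Nb] := leP b ((k + N%:Z)%:~R * d); first exact: IH.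
    have [Na|aN] := leP ((k + N%:Z)%:~R * d) a; first exact: one Na ab bN.
    apply: (@piecewise_C1_on_cat _ _ _ _ ((k + N%:Z)%:~R * d)).
      exact: IH.
    exact: (one (k + N%:Z)).
  move=> a b ab.
  have [k /andP[ka ak]] := period_index a; have [l /andP[lb bl]] := period_index b.
  have kl : (k < l + 1)%R.
    by rewrite -(@ltr_int R) -(ltr_pM2r d_gt0) (le_lt_trans ka)// (lt_trans ab).
  apply: (many k (absz (l + 1 - k)%R) a b ka ab).
  by rewrite gez0_abs ?subr_ge0 ?(ltW kl)// addrC subrK ltW.
- by move=> t; have [f [[->|->] ? _]] := right t; [left|right].
Qed.

(** The second arc ends at time 0, so it enters each period shifted by d. The equality at 0 closes
    the curve at the end of the period; the other one joins the arcs at the switching time kappa. *)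
Lemma two_cycle_of_arcs (z1 v1 z2 v2 : R -> 'rV[R]_n) :
  continuous v1 ->
  (forall t, 0 <= t <= kappa -> is_derive t 1 z1 (v1 t) /\ v1 t = f1 (z1 t)) ->
  continuous v2 ->
  (forall t, kappa - d <= t <= 0 -> is_derive t 1 z2 (v2 t) /\ v2 t = f2 (z2 t)) ->
  z1 0 = z2 0 -> z1 kappa = z2 (kappa - d) ->
  exists x, two_cycle f1 f2 x /\
    forall t, (exists2 s, 0 <= s <= kappa & x t = z1 s) \/
              (exists2 s, kappa - d <= s <= 0 & x t = z2 s).
Proof.
move=> v1c z1E v2c z2E z12 z12k.
pose arc s := if s <= kappa then z1 s else z2 (s - d).
pose x t := arc (t - (Num.floor (t / d))%:~R * d).
have xE (k : int) t : k%:~R * d <= t < (k + 1)%:~R * d -> x t = arc (t - k%:~R * d).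
  move=> kt; rewrite /x (@floor_def _ _ k)//.
  by rewrite ler_pdivlMr// ltr_pdivrMr.
have x1 (k : int) t : k%:~R * d <= t <= k%:~R * d + kappa -> x t = z1 (t - k%:~R * d).
  move=> /andP[kt tk]; rewrite (xE k) /arc; first by rewrite lerBlDl tk.
  by rewrite kt period_end /= (le_lt_trans tk)// ltrD2l.
(* Both ends are included although [x] is computed there by [z1]: the left end uses [z12k], and the
   right end, which belongs to the next period, uses [z12]. *)
have x2 (k : int) t : k%:~R * d + kappa <= t <= (k + 1)%:~R * d ->
    x t = z2 (t - (k + 1)%:~R * d).
  move=> /andP[kt]; rewrite le_eqVlt => /predU1P[->|tk].
    by rewrite (x1 (k + 1)) ?lexx ?lerDl ?ltW// subrr.
  rewrite (xE k); last by rewrite tk andbT (le_trans _ kt)// lerDl ltW.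
  rewrite /arc period_end opprD addrA; case: ifPn => // tkk.
  have -> : t - k%:~R * d = kappa by apply/eqP; rewrite eq_le tkk/= lerBrDl.
  exact: z12k.
exists x; split.
  apply: two_cycle_of_segments.
  - move=> t; have [k kt] := period_index t.
    rewrite (xE k t kt) (xE (k + 1)).
      by rewrite period_end opprD addrACA subrr addr0.
    by rewrite !period_end lerD2r ltrD2r -period_end.
  - move=> k; exists (fun t => z1 (t - k%:~R * d)), (fun t => v1 (t - k%:~R * d)).
    have kt t : k%:~R * d <= t <= k%:~R * d + kappa -> 0 <= t - k%:~R * d <= kappa.
      by rewrite subr_ge0 lerBlDl.
    split.
    + move=> t; apply: (@continuous_comp _ _ _ (fun t => t - k%:~R * d) v1); last exact: v1c.
      by apply: continuousB; [exact: cvg_id|exact: cvg_cst].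
    + by move=> t; exact: x1.
    + by move=> t /kt/z1E[? _]; exact: is_derive_translate.
    + by move=> t tk; rewrite (x1 k)//; case: (z1E _ (kt _ tk)).
  - move=> k; exists (fun t => z2 (t - (k + 1)%:~R * d)), (fun t => v2 (t - (k + 1)%:~R * d)).
    have kt t : k%:~R * d + kappa <= t <= (k + 1)%:~R * d ->
        kappa - d <= t - (k + 1)%:~R * d <= 0.
      by rewrite period_end; move: kappa_lt; lra.
    split.
    + move=> t; apply: (@continuous_comp _ _ _ (fun t => t - (k + 1)%:~R * d) v2); last exact: v2c.
      by apply: continuousB; [exact: cvg_id|exact: cvg_cst].
    + by move=> t; exact: x2.
    + by move=> t /kt/z2E[? _]; exact: is_derive_translate.
    + by move=> t tk; rewrite (x2 k)//; case: (z2E _ (kt _ tk)).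
move=> t; have [k /andP[kt tk]] := period_index t.
have [tkk|kkt] := leP t (k%:~R * d + kappa).
  by left; exists (t - k%:~R * d); [rewrite subr_ge0 kt lerBlDl|apply: x1; rewrite kt].
right; exists (t - (k + 1)%:~R * d); last by apply: x2; rewrite !ltW.
by move: tk kkt kappa_lt; rewrite period_end; lra.
Qed.

End Gluing.

(** * Existence of the cycle *)

(** With c = k1 / k2 one has f2 x = - c f1 x, and both sides equal - c |f1 x|^2 in the Euclidean
    norm. *)
Lemma stasis_point_of_opposite (R : realType) (n : nat)
    (f1 f2 : 'rV[R]_n -> 'rV[R]_n) (x : 'rV[R]_n) (k1 k2 : R) :
  0 < k1 -> 0 < k2 -> k1 *: f1 x + k2 *: f2 x = 0 -> stasis_point f1 f2 x.
Proof.
move=> k10 k20 k0; pose c := k1 / k2.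
have c0 : 0 <= c by rewrite divr_ge0// ltW.
rewrite /stasis_point /euclidean_norm.
have -> : f2 x = - (c *: f1 x) :> 'rV[R]_n.
  apply: (scalerI (lt0r_neq0 k20)).
  rewrite scalerN scalerA mulrCA divff ?lt0r_neq0// mulr1.
  by apply/eqP; rewrite -addr_eq0 addrC k0.
have dotE : dot (f1 x) (- (c *: f1 x)) = - (c * dot (f1 x) (f1 x)).
  rewrite /dot mulr_sumr -sumrN; apply: eq_bigr => i _.
  by rewrite !mxE; ring.
have dotE2 : dot (- (c *: f1 x)) (- (c *: f1 x)) = c ^+ 2 * dot (f1 x) (f1 x).
  rewrite /dot mulr_sumr; apply: eq_bigr => i _.
  by rewrite !mxE; ring.
have dot0 : 0 <= dot (f1 x) (f1 x) by apply: sumr_ge0 => i _; rewrite -expr2 sqr_ge0.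
rewrite dotE dotE2 sqrtrM ?sqr_ge0// sqrtr_sqr ger0_norm//.
by rewrite mulrCA -expr2 sqr_sqrtr.
Qed.

Lemma jacobian_comb (R : realType) (n : nat) (f1 f2 : 'rV[R]_n -> 'rV[R]_n)
    (x : 'rV[R]_n) (k1 k2 : R) : differentiable f1 x -> differentiable f2 x ->
  jacobian (fun y : 'rV[R]_n => k1 *: f1 y + k2 *: f2 y) x =
  k1 *: jacobian f1 x + k2 *: jacobian f2 x.
Proof.
move=> d1 d2.
have dk1 : differentiable (k1 *: f1) x by exact: differentiableZ.
have dk2 : differentiable (k2 *: f2) x by exact: differentiableZ.
have comb v : 'D_v (fun y : 'rV[R]_n => k1 *: f1 y + k2 *: f2 y) x =
    k1 *: 'D_v f1 x + k2 *: 'D_v f2 x.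
  rewrite -(deriveZ k1 (@diff_derivable _ _ _ f1 x v d1)) -(deriveZ k2 (@diff_derivable _ _ _ f2 x v d2)).
  by apply: deriveD; exact: diff_derivable.
apply/row_matrixP => i; rewrite rowE [RHS]rowE.
have := comb (delta_mx 0 i).
rewrite (deriveEjacobian _ d1) (deriveEjacobian _ d2).
rewrite deriveEjacobian; last exact: (differentiableD dk1 dk2).
by move=> ->; rewrite [RHS]mulmxDr !scalemxAr.
Qed.

Lemma exists_small (R : realType) (c1 c2 c3 e1 e2 e3 : R) :
  0 <= c1 -> 0 <= c2 -> 0 <= c3 -> 0 < e1 -> 0 < e2 -> 0 < e3 ->
  exists T : R, [/\ 0 < T, c1 * T <= e1, c2 * T <= e2 & c3 * T <= e3].
Proof.
have pos (c e : R) : 0 <= c -> 0 < e -> 0 < e / (c + 1).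
  by move=> c0 e0; rewrite divr_gt0// ltr_wpDl.
have small (c e T : R) : 0 <= c -> 0 < e -> 0 < T -> T <= e / (c + 1) -> c * T <= e.
  move=> c0 e0 T0; rewrite ler_pdivlMr ?ltr_wpDl// => H.
  by apply: le_trans H; rewrite mulrC ler_wpM2l ?(ltW T0)// lerDl.
move=> c10 c20 c30 e10 e20 e30.
pose T := Num.min (e1 / (c1 + 1)) (Num.min (e2 / (c2 + 1)) (e3 / (c3 + 1))).
have T0 : 0 < T by rewrite !lt_min !pos.
by exists T; split => //; apply: small => //; rewrite /T !ge_min lexx ?orbT.
Qed.

Lemma two_cycle_near_zero (R : realType) (n : nat)
    (f1 f2 : 'rV[R]_n -> 'rV[R]_n) (J1 J2 : 'M[R]_n) (x0 : 'rV[R]_n) (k1 k2 rU : R) :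
  (forall eta, 0 < eta -> exists2 r, 0 < r & forall a b,
    `|a - x0| <= r -> `|b - x0| <= r -> `|f1 a - f1 b - (a - b) *m J1| <= eta * `|a - b|) ->
  (forall eta, 0 < eta -> exists2 r, 0 < r & forall a b,
    `|a - x0| <= r -> `|b - x0| <= r -> `|f2 a - f2 b - (a - b) *m J2| <= eta * `|a - b|) ->
  0 < k1 -> 0 < k2 -> k1 *: f1 x0 + k2 *: f2 x0 = 0 ->
  k1 *: J1 + k2 *: J2 \in unitmx -> 0 < rU ->
  exists x, two_cycle f1 f2 x /\ forall t, `|x t - x0| <= rU.
Proof.
move=> S1 S2 k10 k20 k0; set A := _ + _ => Aunit rU0.
(* K bounds multiplication by A^-1, see [mulA]; the [+ 1] makes it positive. *)
pose K := n%:R * `|invmx A| + 1.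
have K0 : 0 < K by rewrite ltr_wpDl// mulr_ge0.
have k120 : 0 < k1 + k2 by rewrite addr_gt0.
(* The two arcs contribute an error 4 eta (k1 + k2) e |p - q| to W(p) - W(q). After multiplication
   by K / e, this choice of eta leaves exactly |p - q| / 2. *)
pose eta := (8 * K * (k1 + k2))^-1.
have eta0 : 0 < eta by rewrite invr_gt0 !mulr_gt0.
have [r1 r10 {}S1] := S1 _ eta0.
have [r2 r20 {}S2] := S2 _ eta0.
pose r := Num.min (Num.min r1 r2) rU.
have r0 : 0 < r by rewrite !lt_min r10 r20.
have rr1 : r <= r1 by rewrite /r !ge_min lexx.
have rr2 : r <= r2 by rewrite /r !ge_min lexx orbT.
have rrU : r <= rU by rewrite /r !ge_min lexx !orbT.
have {}S1 a b (ar : `|a - x0| <= r) (br : `|b - x0| <= r) :=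
  S1 a b (le_trans ar rr1) (le_trans br rr1).
have {}S2 a b (ar : `|a - x0| <= r) (br : `|b - x0| <= r) :=
  S2 a b (le_trans ar rr2) (le_trans br rr2).
pose L := eta + n%:R * `|J1| + n%:R * `|J2|.
have nJ1 : 0 <= n%:R * `|J1| by rewrite mulr_ge0.
have nJ2 : 0 <= n%:R * `|J2| by rewrite mulr_ge0.
have L1 : eta + n%:R * `|J1| <= L by rewrite lerDl.
have L2 : eta + n%:R * `|J2| <= L by rewrite /L addrAC lerDl.
have L0 : 0 <= L by rewrite !addr_ge0// ltW.
have Lip1 := lipschitz_of_strict S1 L1.
have Lip2 := lipschitz_of_strict S2 L2.
pose M := `|f1 x0| + `|f2 x0| + L * r.
have M0 : 0 <= M by rewrite !addr_ge0// mulr_ge0// ltW.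
have x0r : `|x0 - x0| <= r by rewrite subrr normr0 ltW.
have bnd (f : 'rV[R]_n -> 'rV[R]_n) (a : 'rV[R]_n) :
    (forall a b, `|a - x0| <= r -> `|b - x0| <= r -> `|f a - f b| <= L * `|a - b|) ->
    `|a - x0| <= r -> `|f a| <= `|f x0| + L * r.
  move=> fL ar; rewrite -[f a](subrK (f x0)) addrC (le_trans (ler_normD _ _))//.
  by rewrite lerD2l (le_trans (fL _ _ ar x0r))// ler_wpM2l.
have M1 a : `|a - x0| <= r -> `|f1 a| <= M.
  by move=> /(bnd _ _ Lip1)/le_trans; apply; rewrite /M lerD2r lerDl.
have M2 a : `|a - x0| <= r -> `|f2 a| <= M.
  by move=> /(bnd _ _ Lip2)/le_trans; apply; rewrite /M lerD2r lerDr.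
have [T [T0 LT MT LLT]] : exists T, [/\ 0 < T, L * T <= 2^-1, M * T <= r / 2
    & L * L * T <= eta].
  by apply: exists_small; rewrite ?mulr_ge0 ?divr_gt0.
rewrite -mulrA in LLT.
(* One solution is chosen for each initial point separately, with a dummy value outside the half
   ball. *)
have /choice[F1 F1P] : forall p, exists zv : (R -> 'rV[R]_n) * (R -> 'rV[R]_n),
    `|p - x0| <= r / 2 -> flow_at f1 x0 r M T p zv.1 zv.2.
  move=> p; have [pr|npr] := pselect (`|p - x0| <= r / 2); last by exists (cst 0, cst 0).
  have [z [v zv]] := local_flow (ltW r0) L0 T0 LT MT Lip1 M1 pr.
  by exists (z, v).
have /choice[F2 F2P] : forall p, exists zv : (R -> 'rV[R]_n) * (R -> 'rV[R]_n),
    `|p - x0| <= r / 2 -> flow_at f2 x0 r M T p zv.1 zv.2.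
  move=> p; have [pr|npr] := pselect (`|p - x0| <= r / 2); last by exists (cst 0, cst 0).
  have [z [v zv]] := local_flow (ltW r0) L0 T0 LT MT Lip2 M2 pr.
  by exists (z, v).
(* The last bound gives |G x0 - x0| <= r / 4, half the radius r / 2 of the ball on which G
   contracts. *)
have [e [e0 ek1 ek2 eK]] : exists e, [/\ 0 < e, k1 * e <= T, k2 * e <= T
    & K * (L * M * (k1 ^+ 2 + k2 ^+ 2)) * e <= r / 4].
  have KLM : 0 <= K * (L * M * (k1 ^+ 2 + k2 ^+ 2)).
    by rewrite !mulr_ge0 ?(ltW K0)// addr_ge0// sqr_ge0.
  by apply: exists_small => //; rewrite ?divr_gt0//; exact: ltW.
pose t1 := k1 * e; pose t2 := - (k2 * e).
have t1E : `|t1| = k1 * e by rewrite ger0_norm// ltW// mulr_gt0.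
have t2E : `|t2| = k2 * e by rewrite normrN ger0_norm// ltW// mulr_gt0.
have t1T : `|t1| <= T by rewrite t1E.
have t2T : `|t2| <= T by rewrite t2E.
pose W p := (F1 p).1 t1 - (F2 p).1 t2.
pose G p := p - e^-1 *: (W p *m invmx A).
have mulA (w : 'rV[R]_n) : `|w *m invmx A| <= K * `|w|.
  by rewrite (le_trans (mulmx_norm_le _ _))// ler_wpM2r// lerDl.
have [||p pr Gp] := @contraction_fixed_point _ _ G x0 (r / 2).
- move=> p q pr qr.
  have E1 := flow_at_strict S1 (ltW eta0) L1 T0 LT LLT (F1P p pr) (F1P q qr) t1T.
  have E2 := flow_at_strict S2 (ltW eta0) L2 T0 LT LLT (F2P p pr) (F2P q qr) t2T.
  set E1v := (X in `|X| <= _) in E1; set E2v := (X in `|X| <= _) in E2.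
  have -> : G p - G q = - (e^-1 *: ((E1v - E2v) *m invmx A)).
    have WE : W p - W q = E1v - E2v + e *: ((p - q) *m A).
      rewrite /A mulmxDr -!scalemxAr -/J1 -/J2 /E1v /E2v /W /t1 /t2.
      by apply/rowP => i; rewrite !mxE; ring.
    have -> : G p - G q = (p - q) - e^-1 *: ((W p - W q) *m invmx A).
      by rewrite mulmxBl scalerBr /G !opprD !opprK addrACA.
    rewrite WE mulmxDl -scalemxAl mulmxK// scalerDr scalerA mulVf ?lt0r_neq0// scale1r.
    by rewrite opprD addrCA subrr addr0.
  rewrite normrN mx_normZ gtr0_norm ?invr_gt0//.
  have E12 : `|E1v - E2v| <= 4 * eta * `|p - q| * ((k1 + k2) * e).
    rewrite (le_trans (ler_normB _ _))// (le_trans (lerD E1 E2))//.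
    by rewrite t1E t2E -mulrDr -mulrDl.
  rewrite ler_pdivrMl// (le_trans (mulA _))//.
  apply: (le_trans (ler_wpM2l (ltW K0) E12)).
  rewrite [leLHS](_ : _ = (eta * (8 * K * (k1 + k2))) * (e * (`|p - q| / 2))); last by field.
  by rewrite /eta mulVf ?mul1r// gt_eqF// !mulr_gt0.
- have x0r2 : `|x0 - x0| <= r / 2 by rewrite subrr normr0 divr_ge0// ltW.
  have E1 := flow_at_consistency S1 (ltW eta0) L1 T0 (F1P x0 x0r2) M0 x0r t1T.
  have E2 := flow_at_consistency S2 (ltW eta0) L2 T0 (F2P x0 x0r2) M0 x0r t2T.
  set E1v := (X in `|X| <= _) in E1; set E2v := (X in `|X| <= _) in E2.
  have WE : W x0 = E1v - E2v.
    (* The first-order displacements t1 f1(x0) and t2 f2(x0) are equal, so W(x0) retains only the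
       two second-order errors. *)
    have : e *: (k1 *: f1 x0 + k2 *: f2 x0) = 0 by rewrite k0 scaler0.
    rewrite /W /E1v /E2v /t1 /t2 => k0'; rewrite -[LHS]subr0 -[in LHS]k0'.
    by apply/rowP => i; rewrite !mxE; ring.
  rewrite /G addrAC subrr add0r normrN mx_normZ gtr0_norm ?invr_gt0//.
  have E12 : `|W x0| <= L * M * (k1 ^+ 2 + k2 ^+ 2) * e * e.
    rewrite WE (le_trans (ler_normB _ _))// (le_trans (lerD E1 E2))//.
    by rewrite t1E t2E le_eqVlt; apply/orP; left; apply/eqP; ring.
  rewrite ler_pdivrMl// (le_trans (mulA _))//.
  apply: (le_trans (ler_wpM2l (ltW K0) E12)).
  rewrite [leLHS](_ : _ = e * (K * (L * M * (k1 ^+ 2 + k2 ^+ 2)) * e)); last by ring.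
  by rewrite ler_wpM2l ?(ltW e0)// (le_trans eK)// -mulrA -invfM -natrM.
have W0 : W p = 0.
  have : e^-1 *: (W p *m invmx A) = 0 by rewrite -[LHS](subKr p) -/(G p) Gp subrr.
  move/eqP; rewrite scaler_eq0 invr_eq0 gt_eqF//= => /eqP WA0.
  by rewrite -[W p](mulmxKV Aunit) WA0 mul0mx.
have [z10 v1c z1E v1E] := F1P p pr; have [z20 v2c z2E v2E] := F2P p pr.
have T2 t : `|t| <= T -> - (2 * T) < t by rewrite ler_norml => /andP[? _]; apply: lt_le_trans (_ : - T <= _) => //; rewrite ltrN2 ltr_pMl// ltr1n.
pose kappa := k1 * e; pose d := (k1 + k2) * e.
have kappa0 : 0 < kappa by rewrite mulr_gt0.
have kappad : kappa < d by rewrite /kappa /d mulrDl ltrDl mulr_gt0.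
have kd : kappa - d = t2 by rewrite /kappa /d /t2; ring.
have in1 t : 0 <= t <= kappa -> `|t| <= T.
  by move=> /andP[t0 tk]; rewrite ger0_norm// (le_trans tk).
have in2 t : kappa - d <= t <= 0 -> `|t| <= T.
  by rewrite kd => /andP[tk t0]; rewrite ler0_norm// lerNl (le_trans _ tk)// lerN2.
have [||||||||x [xc xz]] := @two_cycle_of_arcs _ _ f1 f2 kappa d _ _
    (F1 p).1 (F1 p).2 (F2 p).1 (F2 p).2.
- exact: kappa0.
- exact: kappad.
- exact: v1c.
- move=> t /in1 tT; split; first by apply: z1E; exact: T2.
  by case: (v1E t tT).
- exact: v2c.
- move=> t /in2 tT; split; first by apply: z2E; exact: T2.
  by case: (v2E t tT).
- by rewrite z10 z20.
- by rewrite kd; apply/eqP; rewrite -subr_eq0; apply/eqP.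
exists x; split => // t; apply: (le_trans _ rrU).
case: (xz t) => -[s sT ->].
  by case: (v1E s (in1 _ sT)).
by case: (v2E s (in2 _ sT)).
Qed.

Theorem theorem2 (R : realType) (n : nat) (f1 f2 : 'rV[R]_n -> 'rV[R]_n)
    (x0 : 'rV[R]_n) (k1 k2 : R) :
  C1_field f1 -> C1_field f2 ->
  0 < k1 -> 0 < k2 ->
  k1 *: f1 x0 + k2 *: f2 x0 = 0 ->
  stasis_point f1 f2 x0 /\
  (jacobian (fun x : 'rV[R]_n => k1 *: f1 x + k2 *: f2 x) x0 \in unitmx ->
   forall U : set 'rV[R]_n, nbhs x0 U ->
   exists x : R -> 'rV[R]_n, two_cycle f1 f2 x /\ forall t : R, U (x t)).
Proof.
move=> C1 C2 k10 k20 k0; split; first exact: stasis_point_of_opposite k0.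
rewrite jacobian_comb; [|by case: C1|by case: C2].
move=> Aunit U /nbhs_ballP[rU /= rU0 ballU].
(* Half the radius turns the large inequality on |x t - x0| into membership in the open ball. *)
have rU2 : 0 < rU / 2 by rewrite divr_gt0.
have [||x [xc xU]] := two_cycle_near_zero _ _ k10 k20 k0 Aunit rU2.
- by move=> eta; exact: C1_field_strict.
- by move=> eta; exact: C1_field_strict.
exists x; split => // t; apply: ballU; rewrite -ball_normE /ball_ /= distrC.
by rewrite (le_lt_trans (xU t))// gtr_pMr// invf_lt1// ltr1n.
Qed.
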